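(* Suppose that a collection $(H,L_\infty(\cdot),\rho,\bar\gamma,\varepsilon)$, with $H\in\mathbb{R}^{m\times N}$, $\rho\ge0$, $\bar\gamma>0$, $\varepsilon\in(0,1)$, satisfies, together with some $N\times N$ block matrix $V=[V^{k\ell}\in\mathbb{R}^{n_k\times n_\ell}]_{k,\ell=1}^K$, the relations (a) $B=VB+H^TA$; (b) $\|V^{k\ell}\|_{(\ell,k)}\le\bar\gamma$ for all $k,\ell\le K$; (c) $\mathrm{Prob}_\xi\{\Xi^+\}\ge1-\varepsilon$, where $\Xi^+:=\{\xi:\ L_\infty(H^T[u+\xi])\le\rho\ \ \forall u\in\mathcal{U}\}$, and let the parameter $s$ (a positive integer, $s\le K$) of the Non-Euclidean Block Matching Pursuit algorithm satisfy $2\kappa:=2s\bar\gamma<1$. Let $\upsilon\ge0$. Then for all $\xi\in\Xi^+$, $u\in\mathcal{U}$ and $x\in\mathbb{R}^n$ such that $L_1(Bx-[Bx]^s)\le\upsilon$, the algorithm as applied to $y=Ax+u+\xi$ ensures that for every $t=1,2,\dots$ and all $1\le p\le\infty$ one has $$L_p(Bv^{(t)}-Bx)\le s^{1/p}\left[\frac{2\rho+s^{-1}\upsilon}{1-2\kappa}+(2\kappa)^t\left(\frac{s^{-1}(L_{s,1}(H^Ty)+\upsilon)+\rho}{1-\kappa}-\frac{2\rho+s^{-1}\upsilon}{1-2\kappa}\right)\right].$$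
   Context: Setting: $A\in\mathbb{R}^{m\times n}$ is a sensing matrix; $\mathcal{U}\subset\mathbb{R}^m$ is a compact convex set symmetric w.r.t. the origin; $\xi$ is random Gaussian noise, $\xi\sim\mathcal{N}(0,D)$ with known $D\in\mathbb{R}^{m\times m}$. The representation structure $\mathcal{S}=(B,n_1,\dots,n_K,\|\cdot\|_{(1)},\dots,\|\cdot\|_{(K)})$ has $N=n_1+\cdots+n_K$ and $B\in\mathbb{R}^{N\times n}$ of full row rank, and each block norm $\|\cdot\|_{(k)}$ on $\mathbb{R}^{n_k}$ is either $\|\cdot\|_\infty$ or $\|\cdot\|_2$. Vectors $w\in\mathbb{R}^N$ are written in blocks $w=[w[1];\dots;w[K]]$, $w[k]\in\mathbb{R}^{n_k}$; $w_{ji}$ is the $i$th entry of the $j$th block. For $1\le p\le\infty$, $L_p(w)=\|[\|w[1]\|_{(1)};\dots;\|w[K]\|_{(K)}]\|_p$; $w^s$ (also $[w]^s$) is obtained from $w$ by zeroing out all but the $s$ blocks with largest $\|w[k]\|_{(k)}$; $L_{s,p}(w)=L_p(w^s)$. $\|M\|_{(\ell,k)}$ is the norm of $u\mapsto Mu:\mathbb{R}^{n_\ell}\to\mathbb{R}^{n_k}$ induced by $\|\cdot\|_{(\ell)}$ on the argument and $\|\cdot\|_{(k)}$ on the image. $[a]_+=\max\{a,0\}$; $1/\infty=0$. Non-Euclidean Block Matching Pursuit (input $y\in\mathbb{R}^m$; parameters $H,\rho,\bar\gamma,s,\upsilon$): 1. Initialization: $v^{(0)}=0$, $\alpha_0=\frac{L_{s,1}(H^Ty)+s\rho+\upsilon}{1-s\bar\gamma}$.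 2. Step $k=1,2,\dots$: given $v^{(k-1)}\in\mathbb{R}^n$ and $\alpha_{k-1}\ge0$, compute $g=H^T(y-Av^{(k-1)})\in\mathbb{R}^N$ and $\Delta=[\Delta[1];\dots;\Delta[K]]\in\mathbb{R}^N$ by setting, for $j=1,\dots,K$, $$\Delta[j]=\frac{g[j]}{\|g[j]\|_2}\big[\|g[j]\|_2-\bar\gamma\alpha_{k-1}-\rho\big]_+\quad\text{if }\|\cdot\|_{(j)}=\|\cdot\|_2$$ (with $\Delta[j]=0$ if $g[j]=0$), and $$\Delta_{ji}=\mathrm{sign}(g_{ji})\big[|g_{ji}|-\bar\gamma\alpha_{k-1}-\rho\big]_+,\ 1\le i\le n_j,\quad\text{if }\|\cdot\|_{(j)}=\|\cdot\|_\infty.$$ Choose any $v^{(k)}$ such that $B(v^{(k)}-v^{(k-1)})=\Delta$, set $\alpha_k=2s\bar\gamma\alpha_{k-1}+2s\rho+\upsilon$, and pass to step $k+1$. 3. Output: the approximate solution found after $k$ iterations is $v^{(k)}$. *)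

(* Defs.v *)
From HB Require Import structures.
From mathcomp Require Import all_boot all_order all_algebra.
From mathcomp Require Import all_classical all_reals all_analysis.

Set Implicit Arguments.
Unset Strict Implicit.
Unset Printing Implicit Defensive.

Import Order.TTheory GRing.Theory Num.Theory.
Import numFieldNormedType.Exports.

Local Open Scope classical_set_scope.
Local Open Scope ring_scope.

(* The law N(0, sigma ^ 2).  The case sigma = 0 is split off because
   [normal_prob m 0] is, by convention of the library, the uniform law on
   [0, 1] and not the Dirac mass at m. *)
Definition centered_normal_law (R : realType) (sigma : R) (S : set R) : \bar R :=
  if sigma == 0 then \d_(0 : R) S else normal_prob 0 sigma S.

(* xi ~ N(0, D): xi is a random vector, D is symmetric positive semidefinite
   (possibly singular), and every linear form a^T xi is distributed as
   N(0, a^T D a). *)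
Definition centered_gaussian_vector (R : realType) (m : nat)
    (d : measure_display) (Omega : measurableType d) (P : probability Omega R)
    (D : 'M[R]_m) (xi : Omega -> 'cV[R]_m) : Prop :=
  [/\ D^T = D,
      forall a : 'cV[R]_m, 0 <= (a^T *m D *m a) 0 0,
      forall i : 'I_m, measurable_fun [set: Omega] (fun w => xi w i 0)
    & forall (a : 'cV[R]_m) (S : set R), measurable S ->
        P [set w | S ((a^T *m xi w) 0 0)] =
          centered_normal_law (Num.sqrt ((a^T *m D *m a) 0 0)) S].

Variant norm_kind := EuclNorm | SupNorm.

(* The norm `|u| of a matrix is, in the library, the maximal modulus of its
   entries. *)
Definition vnorm (R : realType) (c : norm_kind) (q : nat) (u : 'cV[R]_q) : R :=
  match c with
  | EuclNorm => Num.sqrt (\sum_(i < q) u i 0 ^+ 2)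
  | SupNorm => `|u|
  end.

Definition opnorm (R : realType) (cl ck : norm_kind) (q r : nat)
    (M : 'M[R]_(r, q)) : R :=
  sup [set vnorm ck (M *m u) | u in [set u : 'cV[R]_q | vnorm cl u <= 1]].

(* The l_p norm of a vector of nonnegative reals, p in [1, +oo]; the value
   at p = -oo is never used. *)
Definition lpnorm (R : realType) (p : \bar R) (K : nat) (a : 'I_K -> R) : R :=
  match p with
  | r%:E => (\sum_(k < K) a k `^ r) `^ r^-1
  | _ => \big[Num.max/0]_(k < K) a k
  end.

Definition Lp (R : realType) (K : nat) (nn : 'I_K -> nat)
    (kd : 'I_K -> norm_kind) (p : \bar R) (w : 'cV[R]_(\sum_(k < K) nn k)) : R :=
  lpnorm p (fun k => vnorm (kd k) (submxcol w k)).

(* The s blocks of largest norm; [sort] is stable, so ties are broken in favour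
   of the smaller block index.  [Lps] below and Lp (w - truncate s w) do not
   depend on how ties are broken. *)
Definition top_blocks (R : realType) (K : nat) (nn : 'I_K -> nat)
    (kd : 'I_K -> norm_kind) (s : nat) (w : 'cV[R]_(\sum_(k < K) nn k)) :
    seq 'I_K :=
  take s (sort (fun i j => vnorm (kd j) (submxcol w j)
                             <= vnorm (kd i) (submxcol w i))
               (enum 'I_K)).

(* w^s *)
Definition truncate (R : realType) (K : nat) (nn : 'I_K -> nat)
    (kd : 'I_K -> norm_kind) (s : nat) (w : 'cV[R]_(\sum_(k < K) nn k)) :
    'cV[R]_(\sum_(k < K) nn k) :=
  \mxcol_(k < K) (if k \in top_blocks kd s w then submxcol w k else 0).

(* L_{s,p} *)
Definition Lps (R : realType) (K : nat) (nn : 'I_K -> nat)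
    (kd : 'I_K -> norm_kind) (s : nat) (p : \bar R)
    (w : 'cV[R]_(\sum_(k < K) nn k)) : R :=
  Lp kd p (truncate kd s w).

(* Xi^+ *)
Definition Xi_plus (R : realType) (m K : nat) (nn : 'I_K -> nat)
    (kd : 'I_K -> norm_kind) (U : set 'cV[R]_m)
    (H : 'M[R]_(m, \sum_(k < K) nn k)) (rho : R) : set 'cV[R]_m :=
  [set xi | forall u, U u -> Lp kd +oo%E (H^T *m (u + xi)) <= rho].

(* For the Euclidean norm and g = 0 the result is 0, as 0^-1 = 0. *)
Definition shrink (R : realType) (c : norm_kind) (q : nat) (thr : R)
    (g : 'cV[R]_q) : 'cV[R]_q :=
  match c with
  | EuclNorm => (Num.max (vnorm EuclNorm g - thr) 0 / vnorm EuclNorm g) *: g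
  | SupNorm => \col_(i < q) (Num.sg (g i 0) * Num.max (`|g i 0| - thr) 0)
  end.

Fixpoint nebmp_alpha (R : realType) (m K : nat) (nn : 'I_K -> nat)
    (kd : 'I_K -> norm_kind) (H : 'M[R]_(m, \sum_(k < K) nn k))
    (rho gamma : R) (s : nat) (ups : R) (y : 'cV[R]_m) (k : nat) : R :=
  match k with
  | 0%N => (Lps kd s 1%E (H^T *m y) + s%:R * rho + ups) / (1 - s%:R * gamma)
  | k'.+1 => 2 * s%:R * gamma * nebmp_alpha kd H rho gamma s ups y k'
             + 2 * s%:R * rho + ups
  end.

(* v is a sequence of iterates that Non-Euclidean Block Matching Pursuit may
   produce on the input y; at each step any solution of the linear system
   B (v_k - v_{k-1}) = Delta is allowed. *)
Definition nebmp_run (R : realType) (m n K : nat) (nn : 'I_K -> nat)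
    (kd : 'I_K -> norm_kind) (A : 'M[R]_(m, n))
    (B : 'M[R]_(\sum_(k < K) nn k, n)) (H : 'M[R]_(m, \sum_(k < K) nn k))
    (rho gamma : R) (s : nat) (ups : R) (y : 'cV[R]_m)
    (v : nat -> 'cV[R]_n) : Prop :=
  v 0%N = 0 /\
  forall k : nat,
    let g := H^T *m (y - A *m v k) in
    let thr := gamma * nebmp_alpha kd H rho gamma s ups y k + rho in
    B *m (v k.+1 - v k) = \mxcol_(j < K) shrink (kd j) thr (submxcol g j).

(* Main.v *)
Require Import Defs.
From HB Require Import structures.
From mathcomp Require Import all_boot all_order all_algebra.
From mathcomp Require Import all_classical all_reals all_analysis.
From mathcomp Require Import ring lra.

Set Implicit Arguments.
Unset Strict Implicit.
Unset Printing Implicit Defensive.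

Import Order.TTheory GRing.Theory Num.Theory.
Import numFieldNormedType.Exports.

Local Open Scope classical_set_scope.
Local Open Scope ring_scope.

(** The error [z t = B x - B v_t] is driven through its residual.  The relation
    [B = V B + H^T A] gives [g = z - V z + H^T (u + xi)] for the vector
    [g = H^T (y - A v_t)] seen by the algorithm, so every block of [g] is within
    [thr = gamma * a + rho] of the same block of [z] as soon as [L_1 z <= a]
    ([residual_bound]).

    Shrinking a block [g] by [thr] when [|g - z| <= thr] produces a correction
    [delta] with [|z - delta| <= min (|z|, 2 thr)] ([vnorm_sub_shrink]).
    Consequently
    - no block of the error ever grows, so it stays below the corresponding
      block of the initial error [B x];
    - after one step every block is at most [2 thr].
    Bounding the [s] blocks on which [B x] is largest by [2 thr], and the others
    by their value in [B x], whose sum is at most [ups], yields, for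
    [a = alpha t],
    [L_1 (z (t+1)) <= 2 s thr + ups = alpha (t+1)] ([pursuit_step]).  The
    induction starts from [L_1 (B x) <= alpha 0] ([initial_error]), where the
    maximality of [L_{s,1}] among sums over [s] blocks enters
    ([ler_sum_largest]).

    For [t >= 1] one thus has both [L_1 (z t) <= alpha t] and
    [L_oo (z t) <= 2 (gamma * alpha (t-1) + rho) <= alpha t / s], whence
    [L_p (z t) <= s^(1/p) * (alpha t / s)] by interpolation
    ([lpnorm_interpolation]); solving the affine recursion for [alpha t / s]
    ([alpha_closed_form]) gives the stated expression. *)

(** * Euclidean and uniform norms on column vectors *)

Definition dot (R : realType) (q : nat) (u v : 'cV[R]_q) : R :=
  \sum_(i < q) u i 0 * v i 0.

Section EntrywiseNorms.
Context {R : realType} {q : nat}.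
Implicit Types u v w : 'cV[R]_q.

Lemma dotC u v : dot u v = dot v u.
Proof. by apply: eq_bigr => i _; rewrite mulrC. Qed.

Lemma dotDl u v w : dot (u + v) w = dot u w + dot v w.
Proof.
by rewrite /dot -big_split/=; apply: eq_bigr => i _; rewrite mxE mulrDl.
Qed.

Lemma dotZl a u v : dot (a *: u) v = a * dot u v.
Proof.
by rewrite /dot big_distrr/=; apply: eq_bigr => i _; rewrite mxE mulrA.
Qed.

Lemma dotZr a u v : dot u (a *: v) = a * dot u v.
Proof. by rewrite dotC dotZl dotC. Qed.

Lemma dot_sqrD u v : dot (u + v) (u + v) = dot u u + 2 * dot u v + dot v v.
Proof. by rewrite dotDl !(dotC _ (u + v)) !dotDl (dotC v u); ring. Qed.

Lemma dot_ge0 u : 0 <= dot u u.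
Proof. by apply: sumr_ge0 => i _; rewrite -expr2 sqr_ge0. Qed.

Lemma eucl_ge0 u : 0 <= vnorm EuclNorm u.
Proof. exact: sqrtr_ge0. Qed.

Lemma eucl_sqr u : vnorm EuclNorm u ^+ 2 = dot u u.
Proof.
rewrite /vnorm sqr_sqrtr; first by apply: eq_bigr => i _; rewrite expr2.
by apply: sumr_ge0 => i _; rewrite sqr_ge0.
Qed.

Lemma ler_eucl u v :
  (vnorm EuclNorm u <= vnorm EuclNorm v) = (dot u u <= dot v v).
Proof. by rewrite -!eucl_sqr ler_sqr ?nnegrE ?eucl_ge0. Qed.

Lemma entry_le_eucl u i : `|u i 0| <= vnorm EuclNorm u.
Proof.
rewrite -(@ler_sqr R) ?nnegrE ?eucl_ge0 ?normr_ge0// real_normK ?num_real//.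
rewrite eucl_sqr /dot (bigD1 i)//= -expr2 lerDl.
by apply: sumr_ge0 => j _; rewrite -expr2 sqr_ge0.
Qed.

(** Cauchy-Schwarz, from the nonnegativity of
    [dot (|v| u - |u| v) (|v| u - |u| v)]. *)
Lemma dot_le_eucl u v : dot u v <= vnorm EuclNorm u * vnorm EuclNorm v.
Proof.
have zero_dot w w' : vnorm EuclNorm w = 0 -> dot w w' = 0.
  move=> w0; apply: big1 => i _; have := entry_le_eucl w i.
  by rewrite w0 normr_le0 => /eqP ->; rewrite mul0r.
have [u0|u_neq0] := eqVneq (vnorm EuclNorm u) 0.
  by rewrite u0 mul0r zero_dot.
have [v0|v_neq0] := eqVneq (vnorm EuclNorm v) 0.
  by rewrite v0 mulr0 dotC zero_dot.
set a := vnorm _ u in u_neq0 *; set b := vnorm _ v in v_neq0 *.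
have a_gt0 : 0 < a by rewrite lt0r u_neq0 eucl_ge0.
have b_gt0 : 0 < b by rewrite lt0r v_neq0 eucl_ge0.
have := dot_ge0 (b *: u + (- a) *: v).
rewrite dot_sqrD !(dotZl, dotZr) -(eucl_sqr u) -(eucl_sqr v) -/a -/b => h.
have : 0 <= 2 * (a * b) * (a * b - dot u v).
  by apply: (le_trans h); rewrite le_eqVlt; apply/orP; left; apply/eqP; ring.
by rewrite pmulr_rge0 ?subr_ge0// !mulr_gt0.
Qed.

Lemma eucl_triangle u v :
  vnorm EuclNorm (u + v) <= vnorm EuclNorm u + vnorm EuclNorm v.
Proof.
rewrite -(@ler_sqr R) ?nnegrE ?addr_ge0 ?eucl_ge0//.
rewrite sqrrD !eucl_sqr dot_sqrD.
have := dot_le_eucl u v; lra.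
Qed.

Lemma eucl_scale a u : vnorm EuclNorm (a *: u) = `|a| * vnorm EuclNorm u.
Proof.
apply/eqP; rewrite -(@eqrXn2 R 2) ?mulr_ge0 ?normr_ge0 ?eucl_ge0//.
rewrite exprMn real_normK ?num_real// !eucl_sqr dotZl dotZr.
by apply/eqP; ring.
Qed.

Lemma sup_leP u C : 0 <= C ->
  reflect (forall i, `|u i 0| <= C) (vnorm SupNorm u <= C).
Proof.
move=> C0; apply: (iffP idP) => [uC i|uC]; last first.
  rewrite /vnorm /Num.norm/= mx_normrE; apply: bigmax_le => // -[i j] _ /=.
  by rewrite ord1.
apply: le_trans uC; rewrite /vnorm {2}/Num.norm/= mx_normrE.
exact: (le_bigmax 0 (fun ij : 'I_q * 'I_1 => `|u ij.1 ij.2|) (i, 0)).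
Qed.

End EntrywiseNorms.

Section BlockNorm.
Context {R : realType} (c : norm_kind).

Lemma vnorm_ge0 q (u : 'cV[R]_q) : 0 <= vnorm c u.
Proof. by case: c => /=; [exact: sqrtr_ge0 | exact: normr_ge0]. Qed.

Lemma vnormZ q a (u : 'cV[R]_q) : vnorm c (a *: u) = `|a| * vnorm c u.
Proof. by case: c; [exact: eucl_scale | exact: normrZ]. Qed.

Lemma vnorm0 q : vnorm c (0 : 'cV[R]_q) = 0.
Proof. by rewrite -(scale0r 0) vnormZ normr0 mul0r. Qed.

Lemma vnormN q (u : 'cV[R]_q) : vnorm c (- u) = vnorm c u.
Proof. by rewrite -scaleN1r vnormZ normrN1 mul1r. Qed.

Lemma vnormD q (u v : 'cV[R]_q) : vnorm c (u + v) <= vnorm c u + vnorm c v.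
Proof. by case: c; [exact: eucl_triangle | exact: ler_normD]. Qed.

Lemma vnormB q (u v : 'cV[R]_q) : vnorm c (u - v) = vnorm c (v - u).
Proof. by rewrite -vnormN opprB. Qed.

Lemma vnorm_sum q (I : finType) (F : I -> 'cV[R]_q) :
  vnorm c (\sum_i F i) <= \sum_i vnorm c (F i).
Proof.
elim/big_ind2: _ => [|x y u v xu yv|//]; first by rewrite vnorm0.
exact: le_trans (vnormD _ _) (lerD xu yv).
Qed.

Lemma entry_le_vnorm q (u : 'cV[R]_q) i : `|u i 0| <= vnorm c u.
Proof.
case: c; first exact: entry_le_eucl.
by move: i; apply/sup_leP; rewrite ?normr_ge0.
Qed.

End BlockNorm.

(** * Induced norms *)

(** The set whose supremum is the induced norm is bounded, by the sum of the
    norms of the columns; homogeneity then turns the bound on the unit ball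
    into a bound everywhere. *)
Lemma vnorm_mulmx (R : realType) (cl ck : norm_kind) (q r : nat)
    (M : 'M[R]_(r, q)) (u : 'cV[R]_q) :
  vnorm ck (M *m u) <= opnorm cl ck M * vnorm cl u.
Proof.
have bounded : has_ubound [set vnorm ck (M *m u) | u in
    [set u : 'cV[R]_q | vnorm cl u <= 1]].
  exists (\sum_j vnorm ck (col j M)) => _ [w /= w1 <-].
  have -> : M *m w = \sum_j w j 0 *: col j M.
    apply/colP => i; rewrite mxE summxE; apply: eq_bigr => j _.
    by rewrite !mxE mulrC.
  apply: le_trans (vnorm_sum _ _) _; apply: ler_sum => j _.
  rewrite vnormZ ler_piMl ?vnorm_ge0//.
  exact: le_trans (entry_le_vnorm cl w j) w1.
have [u0|u_neq0] := eqVneq (vnorm cl u) 0.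
  suff -> : u = 0 by rewrite mulmx0 !vnorm0 mulr0.
  apply/colP => i; rewrite mxE; apply/eqP; rewrite -normr_le0 -u0.
  exact: entry_le_vnorm.
have u_gt0 : 0 < vnorm cl u by rewrite lt0r u_neq0 vnorm_ge0.
rewrite -ler_pdivrMr// mulrC -{1}(ger0_norm (vnorm_ge0 cl u)) -normfV.
rewrite -vnormZ scalemxAr; apply: (ub_le_sup bounded).
exists ((vnorm cl u)^-1 *: u) => //=.
by rewrite vnormZ ger0_norm ?invr_ge0 ?vnorm_ge0// mulVf.
Qed.

(** * Shrinkage *)

(** Soft thresholding moves [g] to the point closest to [0] in the interval of
    radius [thr] around [g].  Since [z] lies in that interval too, the shrunk
    value lies between [0] and [z], and at distance at most [2 * thr] from [z]. *)
Lemma scalar_shrink (R : realType) (thr g z : R) : `|g - z| <= thr ->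
  `|z - Num.sg g * Num.max (`|g| - thr) 0| <= Num.min `|z| (2 * thr).
Proof.
rewrite le_min !ler_norml => /andP[gz zg].
have [z_le Nz_le] : z <= `|z| /\ - z <= `|z|.
  by rewrite -{2}normrN !ler_norm.
have z_norm : `|z| = z \/ `|z| = - z.
  by case: (ger0P z) => _; [left|right].
suff [h1 h2 h3 h4] : [/\ - `|z| <= z - Num.sg g * Num.max (`|g| - thr) 0,
    z - Num.sg g * Num.max (`|g| - thr) 0 <= `|z|,
    - (2 * thr) <= z - Num.sg g * Num.max (`|g| - thr) 0
  & z - Num.sg g * Num.max (`|g| - thr) 0 <= 2 * thr] by rewrite h1 h2 h3 h4.
have g_norm : [\/ Num.sg g = 1 /\ `|g| = g, Num.sg g = -1 /\ `|g| = - g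
    | Num.sg g = 0 /\ g = 0].
  by case: (ltrgt0P g) => [g0|g0|->];
    rewrite ?(gtr0_sg g0) ?(ltr0_sg g0) ?sgr0;
    [constructor 1 | constructor 2 | constructor 3].
have g_norm_ge0 := normr_ge0 g.
case: (leP (`|g| - thr) 0) => ?;
  case: z_norm => z_eq; case: g_norm => -[-> g_eq]; split; lra.
Qed.

(** In the Euclidean case with [|g| > thr], the vector [(thr / |g|) *: g] is the
    projection of [g] on the ball of radius [thr], in which [g - z] lies; hence
    [dot (g - z) g <= thr * |g|], that is [dot z g >= (|g| - thr) * |g|], and
    subtracting the shrunk vector from [z] cannot increase its norm. *)
Lemma vnorm_sub_shrink (R : realType) (c : norm_kind) (q : nat) (thr : R)
    (g z : 'cV[R]_q) : vnorm c (g - z) <= thr ->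
  vnorm c (z - shrink c thr g) <= Num.min (vnorm c z) (2 * thr).
Proof.
move=> gz; have thr0 : 0 <= thr by apply: le_trans gz; exact: vnorm_ge0.
case: c gz => gz; last first.
  have bound0 : 0 <= Num.min (vnorm SupNorm z) (2 * thr).
    by rewrite le_min vnorm_ge0 mulr_ge0.
  apply/sup_leP => // i; rewrite !mxE.
  have gzi : `|g i 0 - z i 0| <= thr.
    by have := entry_le_vnorm SupNorm (g - z) i; rewrite !mxE => /le_trans ->.
  apply: le_trans (scalar_shrink gzi) _.
  by rewrite le_min2 ?entry_le_vnorm.
rewrite le_min /shrink; case: (leP (vnorm EuclNorm g - thr) 0) => Ng.
  rewrite mul0r scale0r subr0 lexx andTb.
  have := vnormD EuclNorm g (z - g); rewrite addrC subrK (vnormB _ z g).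
  by move: Ng gz; lra.
set N := vnorm _ g in Ng *; rewrite subr_gt0 in Ng.
have N_gt0 : 0 < N by exact: le_lt_trans Ng.
set a := (N - thr) / N.
have aN : a * N = N - thr by rewrite divfK ?gt_eqF.
have a_ge0 : 0 <= a by rewrite divr_ge0 ?subr_ge0 ?ltW.
have hg : dot (g - z) g <= thr * N.
  by apply: le_trans (dot_le_eucl _ _) _; rewrite -/N ler_pM2r.
apply/andP; split.
  rewrite ler_eucl -scaleNr dot_sqrD !(dotZl, dotZr) -(eucl_sqr g) -/N.
  have zg : N * (a * N) <= dot z g.
    rewrite dotDl -scaleN1r dotZl -(eucl_sqr g) -/N in hg.
    rewrite aN; lra.
  have azg : 0 <= a * (dot z g - N * (a * N)) by rewrite mulr_ge0 ?subr_ge0.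
  have aNN : 0 <= (a * N) * (a * N) by rewrite -expr2 sqr_ge0.
  nra.
have -> : z - a *: g = (1 - a) *: g + (z - g).
  by rewrite scalerBl scale1r [RHS]addrC addrA subrK.
apply: le_trans (vnormD _ _ _) _; rewrite (vnormB _ z g) vnormZ -/N.
have a_le1 : 0 <= 1 - a by rewrite subr_ge0 ler_pdivrMr// mul1r gerBl.
by rewrite ger0_norm// mulrBl mul1r aN; lra.
Qed.

(** * Sums over largest terms, and interpolation between l_1 and l_oo *)

(** Comparing both sums after subtraction of a level [c] that separates the
    values on [T] from the values off [T]: the terms [f i - c] are nonnegative
    on [T] and nonpositive elsewhere. *)
Lemma ler_sum_largest (R : realDomainType) (I : finType) (f : I -> R)
    (T J : {pred I}) : (forall i, 0 <= f i) ->
  (forall i j, i \in T -> j \notin T -> f j <= f i) -> (#|J| <= #|T|)%N ->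
  \sum_(i in J) f i <= \sum_(i in T) f i.
Proof.
move=> f0 fT JT; pose c := \big[Num.max/0]_(i | i \notin T) f i.
have c0 : 0 <= c.
  by apply: (big_ind (fun y => 0 <= y)) => // x y; rewrite le_max => ->.
have cT i : i \in T -> c <= f i.
  by move=> iT; apply: bigmax_le => // j; exact: fT.
have cNT i : i \notin T -> f i <= c.
  by move=> iT; exact: (le_bigmax_cond 0 f iT).
have shift (S : {pred I}) :
    \sum_(i in S) f i = \sum_(i in S) (f i - c) + c *+ #|S|.
  by rewrite -sumr_const -big_split/=; apply: eq_bigr => i _; rewrite subrK.
rewrite !shift; apply: lerD; last exact: ler_wpMn2l.
rewrite [leLHS]big_mkcond [leRHS]big_mkcond/=; apply: ler_sum => i _.
case: (boolP (i \in T)) => iT; case: (i \in J); rewrite ?subr_ge0 ?cT//.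
by rewrite subr_le0 cNT.
Qed.

(** For finite [p = r], each [a k `^ r] is at most [a k * M `^ (r - 1)]. *)
Lemma lpnorm_interpolation (R : realType) (K s : nat) (a : 'I_K -> R) (M : R)
    (p : \bar R) : (1 <= p)%E -> (forall k, 0 <= a k <= M) -> 0 <= M ->
  \sum_k a k <= s%:R * M -> lpnorm p a <= s%:R `^ fine (p^-1)%E * M.
Proof.
move=> p1 aM M0 sum_a; case: p p1 => [r| |]//; last first.
  move=> _; rewrite invey powRr0 mul1r; apply: bigmax_le => // k _.
  by case/andP: (aM k).
rewrite lee_fin => r1; have r0 : 0 < r by exact: lt_le_trans r1.
rewrite fine_invr /lpnorm.
have powR_split x : 0 <= x -> x `^ r = x * x `^ (r - 1).
  move=> x0; have [->|x_neq0] := eqVneq x 0.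
    by rewrite powR0 ?gt_eqF// mul0r.
  by rewrite -{2}(powRr1 x0) -powRD ?x_neq0 ?implybT// addrC subrK.
have sum_ar : \sum_k a k `^ r <= s%:R * M `^ r.
  rewrite (powR_split M)// mulrA.
  apply: (@le_trans _ _ (\sum_k a k * M `^ (r - 1))).
    apply: ler_sum => k _; have /andP[a0 a_le] := aM k.
    by rewrite powR_split// ler_wpM2l// ge0_ler_powR ?nnegrE ?subr_ge0.
  by rewrite -big_distrl/= ler_wpM2r ?powR_ge0.
have r'0 : 0 <= r^-1 by rewrite invr_ge0 ltW.
apply: (@le_trans _ _ ((s%:R * M `^ r) `^ r^-1)).
  apply: ge0_ler_powR; rewrite ?nnegrE ?mulr_ge0 ?powR_ge0//.
  by apply: sumr_ge0 => k _; exact: powR_ge0.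
by rewrite powRM ?powR_ge0// -powRrM mulfV ?gt_eqF// powRr1.
Qed.

(** * Block norms *)

Section Blocks.
Context {R : realType} {K : nat} (nn : 'I_K -> nat) (kd : 'I_K -> norm_kind).
Implicit Types w : 'cV[R]_(\sum_(k < K) nn k).

Definition block_norm w k : R := vnorm (kd k) (submxcol w k).

Lemma block_norm_ge0 w k : 0 <= block_norm w k.
Proof. exact: vnorm_ge0. Qed.

Lemma block_normB w w' k : block_norm (w - w') k = block_norm (w' - w) k.
Proof. by rewrite /block_norm !submxcolB vnormB. Qed.

Lemma block_normD w w' k :
  block_norm (w + w') k <= block_norm w k + block_norm w' k.
Proof. by rewrite /block_norm submxcolD vnormD. Qed.

Lemma Lp1E w : Lp kd 1%E w = \sum_k block_norm w k.
Proof.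
rewrite /Lp /lpnorm invr1 powRr1.
  by apply: eq_bigr => k _; rewrite powRr1// vnorm_ge0.
by apply: sumr_ge0 => k _; exact: powR_ge0.
Qed.

Lemma block_norm_le_Loo w k : block_norm w k <= Lp kd +oo%E w.
Proof. exact: (le_bigmax 0 (block_norm w) k). Qed.

Lemma Lps1E s w : Lps kd s 1%E w = \sum_(k in top_blocks kd s w) block_norm w k.
Proof.
rewrite /Lps Lp1E [RHS]big_mkcond; apply: eq_bigr => k _.
by rewrite /block_norm mxcolK; case: ifP => // _; rewrite vnorm0.
Qed.

Lemma L1_sub_truncate s w : Lp kd 1%E (w - truncate kd s w) =
  \sum_(k | k \notin top_blocks kd s w) block_norm w k.
Proof.
rewrite Lp1E [RHS]big_mkcond; apply: eq_bigr => k _.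
rewrite /block_norm submxcolB mxcolK.
by case: ifP => // _; rewrite ?subrr ?vnorm0 ?subr0.
Qed.

Lemma L1_split s w w' : Lp kd 1%E w =
  \sum_(k in top_blocks kd s w') block_norm w k +
  \sum_(k | k \notin top_blocks kd s w') block_norm w k.
Proof. by rewrite Lp1E (bigID (mem (top_blocks kd s w'))). Qed.

Lemma card_top_blocks s w : (s <= K)%N -> #|top_blocks kd s w| = s.
Proof.
move=> sK; have /card_uniqP -> : uniq (top_blocks kd s w).
  by rewrite take_uniq// sort_uniq enum_uniq.
by rewrite size_takel// size_sort size_enum_ord.
Qed.

Lemma top_blocks_largest s w i j : i \in top_blocks kd s w ->
  j \notin top_blocks kd s w -> block_norm w j <= block_norm w i.
Proof.
rewrite /top_blocks; set leT := (fun _ _ => _); set S := sort _ _.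
have : pairwise leT S.
  rewrite -sorted_pairwise; first by apply: sort_sorted => x y; exact: le_total.
  by move=> y x z xy yz; exact: le_trans yz xy.
have jS : j \in S by rewrite mem_sort mem_enum.
rewrite -{1}(cat_take_drop s S) pairwise_cat => /andP[/allrelP le_TD _] iT jT.
apply: le_TD => //; move: jS.
by rewrite -{1}(cat_take_drop s S) mem_cat (negPf jT).
Qed.

Lemma sum_top_blocks_le_Lps s w w' : (s <= K)%N ->
  \sum_(k in top_blocks kd s w') block_norm w k <= Lps kd s 1%E w.
Proof.
move=> sK; rewrite Lps1E; apply: ler_sum_largest.
- exact: block_norm_ge0.
- exact: top_blocks_largest.
- by rewrite !card_top_blocks.
Qed.

(** Bounding all block norms of [V] by [gamma] controls [V] as an operator from
    the block norm [L_1] to the block norm [L_oo]. *)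
Lemma block_norm_mulmx (V : 'M[R]_(\sum_(k < K) nn k)) gamma w k :
  (forall k l, opnorm (kd l) (kd k) (submxblock V k l) <= gamma) ->
  block_norm (V *m w) k <= gamma * Lp kd 1%E w.
Proof.
move=> V_gamma; have -> : block_norm (V *m w) k =
    vnorm (kd k) (\sum_l submxblock V k l *m submxcol w l).
  rewrite -{1}(submxblockK V) -{1}(submxcolK w) mul_mxblock_mxrow.
  by rewrite /block_norm mxcolK.
apply: le_trans (vnorm_sum _ _) _; rewrite Lp1E big_distrr/=.
apply: ler_sum => l _; apply: le_trans (vnorm_mulmx (kd l) _ _ _) _.
by rewrite ler_wpM2r ?vnorm_ge0.
Qed.

End Blocks.

(** * Convergence of the iterates *)

Section Pursuit.
Context {R : realType} {m n K : nat}.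
Context {nn : 'I_K -> nat} {kd : 'I_K -> norm_kind}.
Context {A : 'M[R]_(m, n)} {B : 'M[R]_(\sum_(k < K) nn k, n)}.
Context {H : 'M[R]_(m, \sum_(k < K) nn k)} {V : 'M[R]_(\sum_(k < K) nn k)}.
Context {rho gamma : R}.
Hypothesis hyp_a : B = V *m B + H^T *m A.
Hypothesis hyp_b :
  forall k l, opnorm (kd l) (kd k) (submxblock V k l) <= gamma.

(** By [hyp_a], the difference is
    [H^T *m eta - V *m (B *m (x - v))]. *)
Lemma residual_bound (eta : 'cV[R]_m) (x v : 'cV[R]_n) k :
  Lp kd +oo%E (H^T *m eta) <= rho ->
  block_norm kd (H^T *m (A *m x + eta - A *m v) - (B *m x - B *m v)) k
    <= gamma * Lp kd 1%E (B *m x - B *m v) + rho.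
Proof.
move=> eta_rho; set z := B *m x - B *m v.
have -> : H^T *m (A *m x + eta - A *m v) - z = H^T *m eta - V *m z.
  have HA : H^T *m A = B - V *m B by rewrite {1}hyp_a addrC addKr.
  have -> : A *m x + eta - A *m v = A *m (x - v) + eta.
    by rewrite mulmxBr addrAC.
  rewrite mulmxDr mulmxA HA /z -mulmxBr mulmxBl -mulmxA.
  by rewrite addrAC [_ - _ - _]addrAC subrr sub0r addrC.
rewrite block_normB; apply: le_trans (block_normD _ _ _ _) _.
apply: lerD; first exact: block_norm_mulmx.
have -> : block_norm kd (- (H^T *m eta)) k = block_norm kd (H^T *m eta) k.
  by rewrite -[in LHS](sub0r (H^T *m eta)) block_normB subr0.
exact: le_trans (block_norm_le_Loo _ _ _) eta_rho.
Qed.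

Context {s : nat} {ups : R} {eta : 'cV[R]_m} {x : 'cV[R]_n}.
Hypothesis s_le_K : (s <= K)%N.
Hypothesis gamma_ge0 : 0 <= gamma.
Hypothesis kappa_lt1 : s%:R * gamma < 1.
Hypothesis eta_rho : Lp kd +oo%E (H^T *m eta) <= rho.
Hypothesis x_sparse : Lp kd 1%E (B *m x - truncate kd s (B *m x)) <= ups.

Let y := A *m x + eta.
Let alpha := nebmp_alpha kd H rho gamma s ups y.

(** With [v = 0] the residual bound compares [H^T *m y] to [B *m x].  Summing
    it over the [s] largest blocks of [B *m x] bounds [L_1 (B *m x)] by itself
    with the factor [s * gamma < 1]. *)
Lemma initial_error : Lp kd 1%E (B *m x) <= alpha 0%N.
Proof.
set T := top_blocks kd s (B *m x).
have top_bound : \sum_(k in T) block_norm kd (B *m x) k <=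
    Lps kd s 1%E (H^T *m y) + (gamma * Lp kd 1%E (B *m x) + rho) *+ s.
  have g_top := sum_top_blocks_le_Lps kd (H^T *m y) (B *m x) s_le_K.
  apply: le_trans (lerD g_top (lexx _)).
  rewrite -{2}(card_top_blocks kd (B *m x) s_le_K) -sumr_const -big_split/=.
  apply: ler_sum => k _.
  have := residual_bound x 0 k eta_rho.
  rewrite !mulmx0 !subr0 -/y block_normB => r.
  rewrite -{1}(subrKC (H^T *m y) (B *m x)).
  by apply: le_trans (block_normD _ _ _ _) _; rewrite lerD2l; exact: r.
have -> : alpha 0%N =
  (Lps kd s 1%E (H^T *m y) + s%:R * rho + ups) / (1 - s%:R * gamma) by [].
rewrite ler_pdivlMr ?subr_gt0//.
move: x_sparse; rewrite L1_sub_truncate -/T => tail.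
have := L1_split kd s (B *m x) (B *m x); rewrite -/T.
rewrite -mulr_natl in top_bound; nra.
Qed.

(** Shrinkage neither enlarges a block of the error nor leaves more than twice
    the threshold; the first bound is used on the small blocks of [B *m x], the
    second on its [s] largest blocks. *)
Lemma pursuit_step (v v' : 'cV[R]_n) (a : R) :
  let thr := gamma * a + rho in
  Lp kd 1%E (B *m x - B *m v) <= a ->
  (forall k, block_norm kd (B *m x - B *m v) k <= block_norm kd (B *m x) k) ->
  B *m (v' - v) =
    \mxcol_(j < K) shrink (kd j) thr (submxcol (H^T *m (y - A *m v)) j) ->
  [/\ Lp kd 1%E (B *m x - B *m v')
        <= 2 * s%:R * gamma * a + 2 * s%:R * rho + ups,
      forall k, block_norm kd (B *m x - B *m v') k <= block_norm kd (B *m x) k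
    & forall k, block_norm kd (B *m x - B *m v') k <= 2 * thr].
Proof.
move=> thr L1a dom step.
have shrunk k : block_norm kd (B *m x - B *m v') k <=
    Num.min (block_norm kd (B *m x - B *m v) k) (2 * thr).
  have -> : B *m x - B *m v' = B *m x - B *m v - B *m (v' - v).
    by rewrite mulmxBr opprB addrA subrK.
  rewrite {1}/block_norm submxcolB step mxcolK; apply: vnorm_sub_shrink.
  rewrite -submxcolB; apply: le_trans (residual_bound x v k eta_rho) _.
  by rewrite lerD2r ler_wpM2l.
have thr_bound k : block_norm kd (B *m x - B *m v') k <= 2 * thr.
  by have := shrunk k; rewrite le_min => /andP[].
have dom' k : block_norm kd (B *m x - B *m v') k <= block_norm kd (B *m x) k.
  have := shrunk k; rewrite le_min => /andP[z_le _].
  exact: le_trans z_le (dom k).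
split=> //; rewrite (L1_split kd s _ (B *m x)).
have -> : 2 * s%:R * gamma * a + 2 * s%:R * rho + ups = (2 * thr) *+ s + ups.
  by rewrite -mulr_natl /thr; ring.
apply: lerD.
  rewrite -{2}(card_top_blocks kd (B *m x) s_le_K) -sumr_const.
  by apply: ler_sum.
apply: le_trans x_sparse; rewrite L1_sub_truncate.
by apply: ler_sum.
Qed.

(** The comparison with the blocks of [B *m x] is part of the invariant because
    [pursuit_step] needs it to control the [L_1] norm of the next error. *)
Lemma pursuit_error (v : nat -> 'cV[R]_n) :
  nebmp_run kd A B H rho gamma s ups y v -> forall t,
  [/\ Lp kd 1%E (B *m x - B *m v t) <= alpha t,
      forall k, block_norm kd (B *m x - B *m v t) k <= block_norm kd (B *m x) k
    & (0 < t)%N -> forall k,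
        block_norm kd (B *m x - B *m v t) k <= 2 * (gamma * alpha t.-1 + rho)].
Proof.
move=> [v0 vS]; elim=> [|t [L1 dom _]].
  by rewrite v0 mulmx0 subr0; split=> //; exact: initial_error.
by have [] := pursuit_step L1 dom (vS t).
Qed.

(** Division by [s] turns the recursion into [b (t+1) = 2 kappa * b t + c] with
    [c = 2 rho + ups / s], whose fixed point is [c / (1 - 2 kappa)]. *)
Lemma alpha_closed_form t : (0 < s)%N -> 2 * (s%:R * gamma) < 1 ->
  let kappa := s%:R * gamma in
  let limit := (2 * rho + s%:R^-1 * ups) / (1 - 2 * kappa) in
  s%:R^-1 * alpha t = limit + (2 * kappa) ^+ t *
    ((s%:R^-1 * (Lps kd s 1%E (H^T *m y) + ups) + rho) / (1 - kappa) - limit).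
Proof.
move=> s_gt0 kappa2 kappa limit.
have s_neq0 : s%:R != 0 :> R by rewrite pnatr_eq0 -lt0n.
have k1 : 1 - s%:R * gamma != 0 by rewrite subr_eq0 eq_sym lt_eqF.
have k2 : 1 - 2 * (s%:R * gamma) != 0 by rewrite subr_eq0 eq_sym lt_eqF.
elim: t => [|t IH].
  rewrite expr0 mul1r subrKC /alpha /nebmp_alpha /kappa.
  by field; rewrite s_neq0 k1.
have -> : alpha t.+1 = 2 * s%:R * gamma * alpha t + 2 * s%:R * rho + ups by [].
have -> : s%:R^-1 * (2 * s%:R * gamma * alpha t + 2 * s%:R * rho + ups) =
    2 * kappa * (s%:R^-1 * alpha t) + (2 * rho + s%:R^-1 * ups).
  by rewrite /kappa; field.
have fixpoint : 2 * rho + s%:R^-1 * ups = (1 - 2 * kappa) * limit.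
  by rewrite /limit [RHS]mulrC divfK.
by rewrite IH fixpoint exprS; ring.
Qed.

End Pursuit.

Theorem proposition6p1 (R : realType) (m n : nat)
    (A : 'M[R]_(m, n))
    (U : set 'cV[R]_m)
    (U_compact : compact U)
    (U_convex : convex_set U)
    (U_symmetric : forall u, U u -> U (- u))
    (d : measure_display) (Omega : measurableType d) (P : probability Omega R)
    (D : 'M[R]_m) (noise : Omega -> 'cV[R]_m)
    (noise_gaussian : centered_gaussian_vector P D noise)
    (K : nat) (nn : 'I_K -> nat) (kd : 'I_K -> norm_kind)
    (B : 'M[R]_(\sum_(k < K) nn k, n))
    (B_full_row_rank : row_free B)
    (H : 'M[R]_(m, \sum_(k < K) nn k))
    (rho gamma eps : R)
    (rho_ge0 : 0 <= rho) (gamma_gt0 : 0 < gamma)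
    (eps_gt0 : 0 < eps) (eps_lt1 : eps < 1)
    (V : 'M[R]_(\sum_(k < K) nn k))
    (hyp_a : B = V *m B + H^T *m A)
    (hyp_b : forall k l : 'I_K, opnorm (kd l) (kd k) (submxblock V k l) <= gamma)
    (hyp_c : ((1 - eps)%:E <= P (noise @^-1` Xi_plus kd U H rho))%E)
    (s : nat) (s_gt0 : (0 < s)%N) (s_le_K : (s <= K)%N)
    (kappa_lt1 : 2 * (s%:R * gamma) < 1)
    (ups : R) (ups_ge0 : 0 <= ups) :
  forall (xi u : 'cV[R]_m) (x : 'cV[R]_n),
    Xi_plus kd U H rho xi ->
    U u ->
    Lp kd 1%E (B *m x - truncate kd s (B *m x)) <= ups ->
    let y := A *m x + u + xi in
    let kappa := s%:R * gamma in
    forall v : nat -> 'cV[R]_n,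
      nebmp_run kd A B H rho gamma s ups y v ->
      forall (t : nat) (p : \bar R), (1 <= t)%N -> (1 <= p)%E ->
        Lp kd p (B *m v t - B *m x) <=
          s%:R `^ fine (p^-1)%E *
            ((2 * rho + s%:R^-1 * ups) / (1 - 2 * kappa) +
             (2 * kappa) ^+ t *
               ((s%:R^-1 * (Lps kd s 1%E (H^T *m y) + ups) + rho) / (1 - kappa)
                - (2 * rho + s%:R^-1 * ups) / (1 - 2 * kappa))).
Proof.
move=> xi u x xiP Uu x_sparse y kappa v run t p t_gt0 p1.
have gamma_ge0 := ltW gamma_gt0.
have kappa_ge0 : 0 <= s%:R * gamma by rewrite mulr_ge0.
have kappa1 : s%:R * gamma < 1 by lra.
have s_pos : 0 < s%:R :> R by rewrite ltr0n.
have y_eq : y = A *m x + (u + xi) by rewrite /y addrA.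
rewrite y_eq in run *.
have eta_rho := xiP u Uu.
have [L1 _ /(_ t_gt0) Loo] := pursuit_error hyp_a hyp_b s_le_K gamma_ge0
  kappa1 eta_rho x_sparse run t.
set a := nebmp_alpha _ _ _ _ _ _ _ in L1 Loo.
rewrite -(alpha_closed_form (kd := kd)) //.
(* [a t] is [s] times the bound in [Loo], plus [ups]. *)
have Loo' k : block_norm kd (B *m x - B *m v t) k <= s%:R^-1 * a t.
  apply: le_trans (Loo k) _; rewrite -ler_pdivrMl ?invr_gt0// invrK /a.
  case: t t_gt0 {L1 Loo} => // t _; rewrite /= -/a.
  by move: ups_ge0; lra.
have a_ge0 : 0 <= s%:R^-1 * a t.
  rewrite mulr_ge0 ?invr_ge0 ?ler0n//; apply: le_trans L1.
  by rewrite Lp1E; apply: sumr_ge0 => k _; exact: block_norm_ge0.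
apply: lpnorm_interpolation => //.
  move=> k; rewrite vnorm_ge0/=; move: (Loo' k).
  by rewrite block_normB.
rewrite mulVKf ?gt_eqF//; apply: le_trans L1; rewrite Lp1E.
by apply: ler_sum => k _; rewrite block_normB.
Qed.
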